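(* Let $\mathbb{K}$ be an algebraically closed field of characteristic zero. Every $A$-covered algebraic variety over $\mathbb{K}$ is an $A$-image.
   Context: An algebraic variety $X$ is an $A$-image if for some positive integer $m$ there is a surjective morphism $\varphi\colon \mathbb{A}^m\to X$. An irreducible algebraic variety $X$ is $A$-covered if there is an open covering $X=U_1\cup\ldots\cup U_r$ where every $U_i$ is isomorphic to the affine space $\mathbb{A}^n$ (with $n=\dim X$). *)

(* Defs.v *)
(* Classical algebraic varieties over
   an algebraically closed field K, in the style of Serre / Mumford (Red Book) /
   Milne ("Algebraic Geometry", ch. 3-4): a variety is a space with a sheaf of
   K-valued functions, covered by finitely many open pieces isomorphic to affine
   algebraic sets, and separated. *)
From HB Require Import structures.
From mathcomp Require Import all_boot all_algebra.
From mathcomp Require Import mpoly.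

Set Implicit Arguments.
Unset Strict Implicit.
Unset Printing Implicit Defensive.

Import GRing.Theory.
Local Open Scope ring_scope.

Section Varieties.
Variable K : fieldType.

(* A space with functions: points, open sets, and for each open U the
   K-valued functions that are regular on U (values outside U irrelevant). *)
Record fspace := FSpace {
  fpt :> Type;
  fopen : (fpt -> Prop) -> Prop;
  freg : (fpt -> Prop) -> (fpt -> K) -> Prop }.

Definition psubset (T : Type) (A B : T -> Prop) := forall x, A x -> B x.

Definition fclosed (X : fspace) (Z : X -> Prop) := @fopen X (fun x => ~ Z x).

Definition is_topology (X : fspace) :=
  [/\ @fopen X (fun _ => True), @fopen X (fun _ => False),
      (forall (I : Type) (F : I -> X -> Prop),
          (forall i, @fopen X (F i)) -> @fopen X (fun x => exists i, F i x)) &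
      (forall U V, @fopen X U -> @fopen X V -> @fopen X (fun x => U x /\ V x))].

Definition is_fsheaf (X : fspace) :=
  [/\ (forall U f, @freg X U f -> @fopen X U),
      (forall U f g, (forall x, U x -> f x = g x) -> @freg X U f -> @freg X U g),
      (forall U V f, @fopen X V -> psubset V U -> @freg X U f -> @freg X V f) &
      (forall U f, @fopen X U ->
         (forall x, U x -> exists V, [/\ @fopen X V, V x, psubset V U & @freg X V f]) ->
         @freg X U f)].

Definition zero_locus n (S : {mpoly K[n]} -> Prop) (x : 'I_n -> K) :=
  forall p, S p -> p.@[x] = 0.

Definition avpt n (S : {mpoly K[n]} -> Prop) := {x : 'I_n -> K | zero_locus S x}.

Definition av_open n (S : {mpoly K[n]} -> Prop) (U : avpt S -> Prop) :=
  exists T : {mpoly K[n]} -> Prop, forall x, U x <-> ~ zero_locus T (sval x).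

Definition av_reg n (S : {mpoly K[n]} -> Prop) (U : avpt S -> Prop) (f : avpt S -> K) :=
  av_open U /\
  forall x, U x -> exists (p q : {mpoly K[n]}) (W : avpt S -> Prop),
    [/\ av_open W, W x, psubset W U &
        forall y, W y -> q.@[sval y] != 0 /\ f y = p.@[sval y] / q.@[sval y]].

Definition affine_fspace n (S : {mpoly K[n]} -> Prop) : fspace :=
  @FSpace (avpt S) (@av_open n S) (@av_reg n S).

Definition affine_space (m : nat) : fspace :=
  affine_fspace (fun _ : {mpoly K[m]} => False).

Definition fmorphism (X Y : fspace) (phi : X -> Y) :=
  (forall V, @fopen Y V -> @fopen X (fun x => V (phi x))) /\
  (forall V g, @freg Y V g -> @freg X (fun x => V (phi x)) (fun x => g (phi x))).

Definition open_iso (Y X : fspace) (phi : Y -> X) (U : X -> Prop) :=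
  [/\ fmorphism phi, injective phi,
      (forall x, U x <-> exists y, phi y = x),
      (forall W, @fopen Y W -> @fopen X (fun x => exists2 y, W y & phi y = x)) &
      (forall W f, @freg Y W f -> exists g,
          @freg X (fun x => exists2 y, W y & phi y = x) g /\
          forall y, W y -> g (phi y) = f y)].

Definition prevariety (X : fspace) :=
  [/\ is_topology X, is_fsheaf X &
      exists (r : nat) (U : 'I_r -> X -> Prop),
        (forall x, exists i, U i x) /\
        forall i, exists (n : nat) (S : {mpoly K[n]} -> Prop)
                         (phi : affine_fspace S -> X), open_iso phi (U i)].

(* Separatedness (Milne, Algebraic Geometry, Def. of separated prevariety):
   for any two morphisms from an affine variety, the locus where they agree
   is closed. *)
Definition separated (X : fspace) :=
  forall (n : nat) (S : {mpoly K[n]} -> Prop) (a b : affine_fspace S -> X),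
    fmorphism a -> fmorphism b -> fclosed (fun z => a z = b z).

Definition variety (X : fspace) := prevariety X /\ separated X.

Definition irreducible (X : fspace) :=
  (exists x : X, True) /\
  forall U V, @fopen X U -> @fopen X V -> (exists x, U x) -> (exists x, V x) ->
    exists x, U x /\ V x.

Definition irr_closed (X : fspace) (Z : X -> Prop) :=
  [/\ fclosed Z, exists x, Z x &
      forall Z1 Z2, fclosed Z1 -> fclosed Z2 -> psubset Z (fun x => Z1 x \/ Z2 x) ->
        psubset Z Z1 \/ psubset Z Z2].

Definition irr_chain (X : fspace) (n : nat) (C : nat -> X -> Prop) :=
  (forall i, (i <= n)%N -> irr_closed (C i)) /\
  (forall i, (i < n)%N -> psubset (C i) (C i.+1) /\ exists x, C i.+1 x /\ ~ C i x).

Definition has_dim (X : fspace) (n : nat) :=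
  (exists C, @irr_chain X n C) /\ ~ (exists C, @irr_chain X n.+1 C).

Definition A_covered (X : fspace) :=
  [/\ variety X, irreducible X &
      exists n : nat, has_dim X n /\
      exists (r : nat) (U : 'I_r -> X -> Prop),
        (forall x, exists i, U i x) /\
        forall i, exists phi : affine_space n -> X, open_iso phi (U i)].

Definition A_image (X : fspace) :=
  variety X /\
  exists (m : nat) (phi : affine_space m -> X),
    fmorphism phi /\ forall x : X, exists y, phi y = x.

End Varieties.

(* Main.v *)
(** Start from one chart [A^n -> X] and enlarge the image chart by chart. Given a
    morphism [f : A^m -> X] whose image contains a nonempty open set, and a chart
    [phi : A^n -> X], write [f = phi (p / q)] on the principal open set [q != 0], put
    [f' (y, s) = phi (p y / q y + G y ^ 2 * s)] where [G y != 0], and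
    [f' (y, s) = f y] where [G y = 0]. Taking [s = 0] recovers the image of [f], and a
    single [y] with [G y != 0] already yields all of [phi (A^n)]. If [phi] is expressed
    in the [j]-th chart by the fractions [Q_j / e_j], let [G] be the product of [q] and
    of the numerators [E_j] of [e_j (p / q)]. Modulo [G ^ 2] the shift by [G ^ 2 * s]
    does nothing, and [G ^ 2] is [E_j] times a multiple of [G]; hence in the [j]-th
    chart [f'] is [(z + g' S) / (1 + g' R)], where [z] is [f] in this chart, [R] and
    [S] are polynomial, and [g'] vanishes with [G]. So [f'] is regular also along
    [G = 0]. *)
Require Import Defs.
From mathcomp Require Import all_boot all_algebra.
From mathcomp Require Import mpoly.
From mathcomp Require Import ring.
From Stdlib Require Import Classical FunctionalExtensionality.

Set Implicit Arguments.
Unset Strict Implicit.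
Unset Printing Implicit Defensive.

Import GRing.Theory.
Local Open Scope ring_scope.

(** * Clearing denominators in polynomials evaluated at fractions *)

Lemma mpoly_ring_ind (R : nzRingType) (n : nat) (P : {mpoly R[n]} -> Prop) :
  (forall c, P c%:MP) -> (forall i, P 'X_i) ->
  (forall p q, P p -> P q -> P (p + q)) ->
  (forall p q, P p -> P q -> P (p * q)) -> forall p, P p.
Proof.
move=> PC PX PD PM; elim/mpolyind => [|c m p _ _ Pp]; first exact: PC.
apply: (PD) => //; rewrite -mul_mpolyC; apply: (PM) => //.
rewrite mpolyXE_id; apply: big_ind => [||i _]; [by rewrite -mpolyC1; apply: (PC) | exact: PM |].
elim: (m i) => [|k IHk]; first by rewrite expr0 -mpolyC1; apply: (PC).
by rewrite exprS; apply: (PM).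
Qed.

Definition mlift (R : comNzRingType) (m n : nat) (p : {mpoly R[m]}) :
    {mpoly R[m + n]} :=
  p \mPo [tuple 'X_(lshift n i) | i < m].

Lemma meval_mlift (R : comNzRingType) (m n : nat) (p : {mpoly R[m]})
    (w : 'I_(m + n) -> R) :
  (mlift n p).@[w] = p.@[fun i => w (lshift n i)].
Proof.
rewrite comp_mpoly_meval; apply: meval_eq => i.
by rewrite tnth_mktuple mevalXU.
Qed.

(* Clearing denominators in [e (p / q)], and first-order Taylor expansion of
   [e (p / q + g s)] in [g], both with the same power of [q]. The remainder is
   a polynomial in the variables of [p], [q], [g] together with [s]. *)
Lemma meval_frac_shift (K : fieldType) (m n : nat) (q : {mpoly K[m]})
    (p : 'I_n -> {mpoly K[m]}) (e : {mpoly K[n]}) :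
  exists M0, forall M, (M0 <= M)%N -> exists E : {mpoly K[m]},
    (forall y, q.@[y] != 0 ->
       E.@[y] = q.@[y] ^+ M * e.@[fun i => (p i).@[y] / q.@[y]]) /\
    forall g : {mpoly K[m]}, exists R : {mpoly K[m + n]}, forall w,
      let y i := w (lshift n i) in q.@[y] != 0 ->
      q.@[y] ^+ M * e.@[fun i => (p i).@[y] / q.@[y] + g.@[y] * w (rshift m i)]
        = E.@[y] + g.@[y] * R.@[w].
Proof.
elim/mpoly_ring_ind: e => [c|i|e1 e2 [M1 H1] [M2 H2]|e1 e2 [M1 H1] [M2 H2]].
- exists 0%N => M _; exists (c%:MP * q ^+ M); split.
    by move=> y _; rewrite !rmorphM rmorphXn /= !mevalC mulrC.
  move=> g; exists 0 => w y _.
  by rewrite !rmorphM rmorphXn /= !mevalC ?meval0; ring.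
- exists 1%N => -[//|M] _; exists (p i * q ^+ M); split.
    move=> y qy; rewrite !rmorphM rmorphXn /= mevalXU exprS; field.
    by rewrite qy.
  move=> g; exists (mlift n q ^+ M.+1 * 'X_(rshift m i)) => w y qy.
  rewrite !(rmorphM, rmorphXn) /= !mevalXU meval_mlift -/y exprS; field.
  by rewrite qy.
(* Allowing every exponent from [M0] on lets both summands use the same power of [q]. *)
- exists (maxn M1 M2) => M; rewrite geq_max => /andP[/H1 [E1 [A1 B1]] /H2 [E2 [A2 B2]]].
  exists (E1 + E2); split.
    by move=> y qy; rewrite !mevalD A1 // A2 // mulrDr.
  move=> g; have [R1 C1] := B1 g; have [R2 C2] := B2 g.
  exists (R1 + R2) => w y qy.
  rewrite !mevalD mulrDr C1 // C2 // -/y; ring.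
(* The power [q ^+ M] is shared out: [M - M2] for the first factor, [M2] for the second. *)
- exists (M1 + M2)%N => M leM.
  have leM2 : (M2 <= M)%N by apply: leq_trans leM; rewrite leq_addl.
  have /H1 [E1 [A1 B1]] : (M1 <= M - M2)%N by rewrite leq_subRL // addnC.
  have /H2 [E2 [A2 B2]] := leqnn M2.
  have qM x : x ^+ M = x ^+ (M - M2) * x ^+ M2 :> K by rewrite -exprD subnK.
  exists (E1 * E2); split.
    by move=> y qy; rewrite !mevalM A1 // A2 // qM; ring.
  move=> g; have [R1 C1] := B1 g; have [R2 C2] := B2 g.
  exists (mlift n E1 * R2 + R1 * mlift n E2 + mlift n g * (R1 * R2)) => w y qy.
  rewrite !mevalM qM mulrACA C1 // C2 // -/y.
  by rewrite !(mevalD, mevalM) !meval_mlift -/y; ring.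
Qed.

Lemma meval_frac (K : fieldType) (m n : nat) (q : {mpoly K[m]})
    (p : 'I_n -> {mpoly K[m]}) (e : {mpoly K[n]}) :
  exists M (E : {mpoly K[m]}), forall y, q.@[y] != 0 ->
    E.@[y] = q.@[y] ^+ M * e.@[fun i => (p i).@[y] / q.@[y]].
Proof.
have [M H] := meval_frac_shift q p e; have [E [HE _]] := H _ (leqnn M).
by exists M, E.
Qed.

(** The factor [a] cancels, and the right-hand side still makes sense where [a] vanishes. With [a]
    the value of [E j] and [t] that of [g'], this carries [f'] across [G = 0]. *)
Lemma frac_shift_eq (K : fieldType) (a b c t u v : K) :
  a != 0 -> c != 0 -> 1 + t * v != 0 ->
  (a * (b / c) + a * t * u) / (a + a * t * v) = (b + c * t * u) / (c * (1 + t * v)).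
Proof.
move=> a0 c0 tv0; have -> : a + a * t * v = a * (1 + t * v) by ring.
by field; rewrite tv0 c0 a0.
Qed.

(** * Zariski open sets, and morphisms given locally by fractions *)

Section AffineSpace.
Variable K : fieldType.
Implicit Types X : fspace K.

Definition aspt (m : nat) (x : 'I_m -> K) : affine_space K m :=
  exist (zero_locus (fun _ => False)) x (fun p => False_ind _).

Lemma aspt_sval (m : nat) (x : affine_space K m) : aspt (sval x) = x.
Proof.
case: x => x hx; rewrite /aspt /=; congr exist.
(* Membership proofs are functions out of [False], so extensionality identifies them. *)
by do 2![apply: functional_extensionality_dep => ?].
Qed.

Lemma av_openP (n : nat) (S : {mpoly K[n]} -> Prop) (U : avpt S -> Prop) :
  av_open U <-> forall x, U x -> exists P : {mpoly K[n]},
    P.@[sval x] != 0 /\ forall y : avpt S, P.@[sval y] != 0 -> U y.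
Proof.
split=> [[T HT] x /HT /not_all_ex_not [P nP]|H].
  have [TP /eqP Px] := imply_to_and _ _ nP; exists P; split=> // y Py.
  by apply/HT => /(_ P TP)/eqP; rewrite (negbTE Py).
(* Take all polynomials whose principal open set lies in [U]. *)
exists (fun P : {mpoly K[n]} => forall y : avpt S, P.@[sval y] != 0 -> U y) => x.
split=> [/H [P [Px HP]] /(_ P HP)/eqP|nx]; first by rewrite (negbTE Px).
have [P nP] := not_all_ex_not _ _ nx.
by have [HP /eqP Px] := imply_to_and _ _ nP; apply: HP.
Qed.

Lemma av_openT (n : nat) (S : {mpoly K[n]} -> Prop) :
  av_open (fun _ : avpt S => True).
Proof. by apply/av_openP => x _; exists 1; rewrite meval1 oner_neq0. Qed.

Lemma av_open_principal (n : nat) (S : {mpoly K[n]} -> Prop) (P : {mpoly K[n]}) :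
  av_open (fun x : avpt S => P.@[sval x] != 0).
Proof. by apply/av_openP => x Px; exists P. Qed.

Definition frac_pt (m n : nat) (b : 'I_n -> {mpoly K[m]}) (c : {mpoly K[m]})
    (y : 'I_m -> K) : affine_space K n :=
  aspt (fun i => (b i).@[y] / c.@[y]).

(** Openness and regularity can be tested near each point, and there a polynomial in the fractions
    [b / c] becomes a polynomial after multiplying by a power of [c]. *)
Lemma fmorphism_of_local_frac X (m n : nat) (F : affine_space K m -> X) :
  (forall w : affine_space K m, exists (psi : affine_space K n -> X)
       (b : 'I_n -> {mpoly K[m]}) (c : {mpoly K[m]}),
     [/\ fmorphism psi, c.@[sval w] != 0 &
         forall y, c.@[y] != 0 -> F (aspt y) = psi (frac_pt b c y)]) ->
  fmorphism F.
Proof.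
move=> locF.
have opF V : (forall psi : affine_space K n -> X, fmorphism psi ->
    av_open (fun x => V (psi x))) -> av_open (fun w => V (F w)).
  move=> oV; apply/av_openP => w Vw; have [psi [b [c [mpsi cw HF]]]] := locF w.
  have /av_openP oW := oV _ mpsi.
  have := Vw; rewrite -[w]aspt_sval HF // => /oW [P [Pw HP]].
  have [M [E HE]] := meval_frac c b P.
  exists (c * E); split.
    by rewrite mevalM mulf_neq0 // HE // mulf_neq0 // expf_neq0.
  move=> w'; rewrite mevalM mulf_eq0 negb_or => /andP[cw'].
  rewrite HE // mulf_eq0 negb_or => /andP[_ Pw'].
  by rewrite -[w']aspt_sval HF //; apply: HP.
split=> [V oV|V g regg]; first by apply: opF => psi [opsi _]; apply: opsi.
split; first by apply: opF => psi [_ rpsi]; case: (rpsi _ _ regg).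
move=> w Vw; have [psi [b [c [[opsi rpsi] cw HF]]]] := locF w.
have [_ rW] := rpsi _ _ regg.
have := Vw; rewrite -[w]aspt_sval HF // => /rW [P [Q [W [/av_openP oW Ww sWV HPQ]]]].
have [T [Tw HT]] := oW _ Ww.
have [MP [EP HEP]] := meval_frac c b P.
have [MQ [EQ HEQ]] := meval_frac c b Q.
have [MT [ET HET]] := meval_frac c b T.
(* The exponents are crossed because [P / Q] pulls back to [(EP / c ^+ MP) / (EQ / c ^+ MQ)]. *)
exists (EP * c ^+ MQ), (EQ * c ^+ MP), (fun y => (c * ET).@[sval y] != 0); split.
- exact: av_open_principal.
- by rewrite mevalM mulf_neq0 // HET // mulf_neq0 // expf_neq0.
- move=> y; rewrite mevalM mulf_eq0 negb_or => /andP[cy].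
  rewrite HET // mulf_eq0 negb_or => /andP[_ Ty].
  by rewrite -[y]aspt_sval HF //; apply/sWV/HT.
move=> y; rewrite mevalM mulf_eq0 negb_or => /andP[cy].
rewrite HET // mulf_eq0 negb_or => /andP[_ Ty].
have [Qy gy] := HPQ _ (HT (frac_pt b c (sval y)) Ty).
rewrite /= in Qy gy; rewrite -[in g _](aspt_sval y) HF // gy.
rewrite !mevalM !rmorphXn /= HEQ // HEP //; split.
  by rewrite !mulf_neq0 // expf_neq0.
by field; rewrite Qy !expf_neq0.
Qed.

Lemma av_reg_coord (n : nat) (S : {mpoly K[n]} -> Prop) (j : 'I_n) :
  av_reg (fun _ : avpt S => True) (fun x => sval x j).
Proof.
split=> [|x _]; first exact: av_openT.
exists 'X_j, 1, (fun _ => True); split=> // [|y _]; first exact: av_openT.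
by rewrite meval1 mevalXU oner_neq0 divr1.
Qed.

(** The coordinates of [f] in the chart [psi] are regular near [y0], hence fractions there, and
    finitely many fractions have a common denominator. *)
Lemma open_iso_frac X (m n : nat) (f : affine_space K m -> X)
    (psi : affine_space K n -> X) (U : X -> Prop) (y0 : affine_space K m) :
  fmorphism f -> open_iso psi U -> U (f y0) ->
  exists (b : 'I_n -> {mpoly K[m]}) (c : {mpoly K[m]}),
    c.@[sval y0] != 0 /\
    forall y, c.@[y] != 0 -> f (aspt y) = psi (frac_pt b c y).
Proof.
move=> [of_ rf] [_ _ HU opsi rpsi] /HU [v0 v0y].
have /av_openP /(_ y0) [] := of_ _ (opsi _ (av_openT (fun=> False))).
  by exists v0.
move=> t0 [t0y Ht0].
(* Here [d] is [(p, q, t)]: the [j]-th coordinate is [p / q] wherever [t * q] is nonzero. *)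
have /fin_all_exists [d Hd] (j : 'I_n) :
    exists d : {mpoly K[m]} * {mpoly K[m]} * {mpoly K[m]},
    (d.2 * d.1.2).@[sval y0] != 0 /\
    forall y, (d.2 * d.1.2).@[y] != 0 -> forall v, psi v = f (aspt y) ->
      sval v j = d.1.1.@[y] / d.1.2.@[y].
  have [g [/rf [_ rg] Hg]] := rpsi _ _ (@av_reg_coord n (fun=> False) j).
  have [|p [q [W [/av_openP oW Wy sW HW]]]] := rg y0; first by exists v0.
  have [t [ty Ht]] := oW _ Wy.
  have [qy _] := HW _ Wy.
  exists (p, q, t); split=> [|y]; rewrite mevalM /=; first exact: mulf_neq0.
  rewrite mulf_eq0 negb_or => /andP[ty' _] v vy.
  by rewrite -Hg // vy; have [_ ->] := HW _ (Ht (aspt y) ty').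
(* [D j] is the cofactor of the [j]-th denominator in [c]. The factors [t0] and [(d i).2] confine
   [c != 0] to where [f] lands in the chart and all the fractions are valid. *)
pose D j := t0 * ((d j).2 * \prod_(i | i != j) ((d i).2 * (d i).1.2)).
pose c := t0 * \prod_i ((d i).2 * (d i).1.2).
have cD j : c = (d j).1.2 * D j by rewrite /c (bigD1 j) //= /D; ring.
clearbody D.
exists (fun j => (d j).1.1 * D j), c; split=> [|y cy].
  rewrite mevalM mulf_neq0 // rmorph_prod /=; apply/prodf_neq0 => i _.
  by have [] := Hd i.
have := cy; rewrite mevalM mulf_eq0 negb_or => /andP[t0y' py].
have [v _ vy] := Ht0 (aspt y) t0y'; rewrite -vy -(aspt_sval v); congr (psi (aspt _)).
apply: functional_extensionality => j; have [_ Hj] := Hd j.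
rewrite (Hj y) //; last first.
  by move: py; rewrite rmorph_prod /= => /prodf_neq0; apply.
move: cy; rewrite (cD j) !mevalM mulf_eq0 negb_or => /andP[qy Dy].
by field; rewrite qy Dy.
Qed.

(** * Generic points, and enlarging the image by one chart *)

Lemma irreducible_meet X (I : eqType) (s : seq I) (O : I -> X -> Prop)
    (V : X -> Prop) :
  is_topology X -> irreducible X -> (forall i, fopen (O i)) ->
  (forall i, exists x, O i x) -> fopen V -> (exists x, V x) ->
  exists x, V x /\ forall i, i \in s -> O i x.
Proof.
move=> [_ _ _ oI] [_ irr] oO neO; elim: s V => [|i s IHs] V oV neV.
  by have [x Vx] := neV; exists x.
have [x [[Vx Ox] Hx]] := IHs _ (oI _ _ oV (oO i)) (irr _ _ oV (oO i) neV (neO i)).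
by exists x; split=> // j; rewrite inE => /predU1P[-> //|/Hx].
Qed.

(** Since [f] covers the nonempty open set [U i0], irreducibility makes its image meet any finite
    intersection of nonempty open sets; this provides a point where [G] is nonzero. *)
Lemma enlarge_image X (n r : nat) (U : 'I_r -> X -> Prop)
    (phi : 'I_r -> affine_space K n -> X) (m : nat)
    (f : affine_space K m -> X) (i0 i1 : 'I_r) :
  is_topology X -> irreducible X ->
  (forall x, exists i, U i x) -> (forall i, open_iso (phi i) (U i)) ->
  fmorphism f -> (forall x, U i0 x -> exists y, f y = x) ->
  exists f' : affine_space K (m + n) -> X,
    [/\ fmorphism f', (forall y, exists w, f' w = f y) &
        forall x, U i1 x -> exists w, f' w = x].
Proof.
move=> topX irrX covU isoU mf imf.
have [m1 inj1 U1 open1 _] := isoU i1.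
have imT i : fopen (fun x => exists2 v, True & phi i v = x).
  by have [_ _ _ H _] := isoU i; apply/H/av_openT.
have imN i : exists x, exists2 v, True & phi i v = x.
  by exists (phi i (aspt (fun=> 0))), (aspt (fun=> 0)).
have Uphi i v : U i (phi i v) by have [_ _ -> _ _] := isoU i; exists v.
(* Transition from chart [i1] to chart [j]: [d] holds the numerators [Q j] and the denominator
   [e j]. *)
have /fin_all_exists [d Hd] (j : 'I_r) :
    exists d : ('I_n -> {mpoly K[n]}) * {mpoly K[n]},
    (exists x, d.2.@[x] != 0) /\
    forall x, d.2.@[x] != 0 -> phi i1 (aspt x) = phi j (frac_pt d.1 d.2 x).
  have [_ [[v1 _ <-] [vj _ vE]]] := irrX.2 _ _ (imT i1) (imT j) (imN i1) (imN j).
  have Uj : U j (phi i1 v1) by rewrite -vE.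
  have [b [c [cv Hc]]] := open_iso_frac m1 (isoU j) Uj.
  by exists (b, c); split=> //; exists (sval v1).
pose e j := (d j).2; pose Q j := (d j).1.
pose O j x := exists2 v : affine_space K n, (e j).@[sval v] != 0 & phi i1 v = x.
have oO j : fopen (O j) by apply/open1/av_open_principal.
have neO j : exists x, O j x.
  by have [[x ex] _] := Hd j; exists (phi i1 (aspt x)), (aspt x).
(* A point of chart [i0] that lies in chart [i1] and at which no [e j] vanishes. *)
have [_ [[v0 _ <-] Hv0]] :=
  irreducible_meet (enum 'I_r) topX irrX oO neO (imT i0) (imN i0).
have [y0 fy0] := imf _ (Uphi i0 v0).
have [x0 _ x0E] := Hv0 i1 (mem_enum _ _).
have ex0 j : (e j).@[sval x0] != 0.
  by have [x ex] := Hv0 j (mem_enum _ _); rewrite -x0E => /inj1 <-.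
have Uy0 : U i1 (f y0) by rewrite fy0 -x0E.
have [p [q [qy0 fpq]]] := open_iso_frac mf (isoU i1) Uy0.
have py0 : frac_pt p q (sval y0) = x0.
  by apply: inj1; rewrite -fpq // aspt_sval fy0.
have /fin_all_exists [h Hh] (j : 'I_r) :
    exists h : nat * {mpoly K[m]} * ('I_n -> {mpoly K[m]}),
    let M := h.1.1 in let E := h.1.2 in let N := h.2 in
    [/\ forall y, q.@[y] != 0 ->
          E.@[y] = q.@[y] ^+ M * (e j).@[sval (frac_pt p q y)],
        forall y k, q.@[y] != 0 ->
          (N k).@[y] = q.@[y] ^+ M * (Q j k).@[sval (frac_pt p q y)] &
        forall g : {mpoly K[m]}, exists R (S : 'I_n -> {mpoly K[m + n]}),
        forall w, let y i := w (lshift n i) in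
          let x' i := (p i).@[y] / q.@[y] + g.@[y] * w (rshift m i) in
          q.@[y] != 0 ->
          q.@[y] ^+ M * (e j).@[x'] = E.@[y] + g.@[y] * R.@[w] /\
          forall k, q.@[y] ^+ M * (Q j k).@[x'] = (N k).@[y] + g.@[y] * (S k).@[w]].
  have [Me He] := meval_frac_shift q p (e j).
  have /fin_all_exists [MQ HQ] := fun k => meval_frac_shift q p (Q j k).
  (* One exponent for [e j] and every [Q j k], so that [q ^+ M] cancels in their quotients. *)
  pose M := maxn Me (\max_k MQ k).
  have [E [HE HR]] := He M (leq_maxl _ _).
  have leM k : (MQ k <= M)%N.
    by apply: leq_trans (leq_maxr _ _); apply: leq_bigmax.
  have /fin_all_exists [N HN] := fun k => HQ k M (leM k).
  exists (M, E, N); split=> //= [y k qy|g]; first by have [-> ] := HN k.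
  have [R HR'] := HR g.
  have /fin_all_exists [S HS] := fun k => (HN k).2 g.
  by exists R, S => w qy; split=> [|k]; [apply: HR' | apply: HS].
pose E j := (h j).1.2.
pose G := q * \prod_j E j; pose g := G * G.
have Gy0 : G.@[sval y0] != 0.
  rewrite mevalM mulf_neq0 // rmorph_prod /=; apply/prodf_neq0 => j _.
  have [-> //] := Hh j; rewrite py0 mulf_neq0 ?expf_neq0 //; exact: ex0.
have q0 y : G.@[y] != 0 -> q.@[y] != 0.
  by rewrite mevalM mulf_eq0 negb_or => /andP[].
have gG y : g.@[y] = G.@[y] * G.@[y] by rewrite mevalM.
have [D GD] : exists D, forall j, G = E j * D j.
  exists (fun j => q * \prod_(i | i != j) E i) => j.
  by rewrite /G (bigD1 j) //=; ring.
clearbody G g.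
pose yy (w : 'I_(m + n) -> K) i := w (lshift n i).
pose xx (w : 'I_(m + n) -> K) i :=
  (p i).@[yy w] / q.@[yy w] + g.@[yy w] * w (rshift m i).
pose f' (w : affine_space K (m + n)) :=
  if G.@[yy (sval w)] == 0 then f (aspt (yy (sval w)))
  else phi i1 (aspt (xx (sval w))).
pose join (y : 'I_m -> K) (s : 'I_n -> K) k :=
  match split k with inl i => y i | inr j => s j end.
have yyJ y s : yy (join y s) = y.
  apply: functional_extensionality => i; rewrite /yy /join.
  by rewrite (unsplitK (inl i)).
have xxJ y s i : xx (join y s) i = (p i).@[y] / q.@[y] + g.@[y] * s i.
  by rewrite /xx yyJ /join (unsplitK (inr i)).
exists f'; split; last first.
- move=> _ /U1 [v <-].
  pose s i := (sval v i - (p i).@[sval y0] / q.@[sval y0]) / g.@[sval y0].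
  exists (aspt (join (sval y0) s)); rewrite /f' /= yyJ (negbTE Gy0).
  rewrite -[in RHS](aspt_sval v); congr (phi _ (aspt _)).
  apply: functional_extensionality => i; rewrite xxJ /s gG.
  by field; rewrite Gy0 q0.
- move=> y; exists (aspt (join (sval y) (fun=> 0))); rewrite /f' /= yyJ aspt_sval.
  case: eqP => // /eqP /q0 qy; rewrite -[in RHS](aspt_sval y) fpq //.
  congr (phi _ (aspt _)); apply: functional_extensionality => i.
  by rewrite xxJ mulr0 addr0.
apply: (@fmorphism_of_local_frac X (m + n) n) => w.
have [Gw|Gw] := eqVneq G.@[yy (sval w)] 0; last first.
  (* The extra factor [G] above and below keeps the neighbourhood inside [G != 0]. *)
  exists (phi i1),
    (fun k => (mlift n (p k) + mlift n (q * g) * 'X_(rshift m k)) * mlift n G),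
    (mlift n (q * G)); split=> // [|y].
    by rewrite meval_mlift mevalM mulf_neq0 // q0.
  rewrite meval_mlift mevalM -/(yy y) mulf_eq0 negb_or => /andP[qy Gy].
  rewrite /f' /= (negbTE Gy); congr (phi _ (aspt _)).
  apply: functional_extensionality => k.
  rewrite /xx !(mevalM, mevalD, meval_mlift) mevalXU -!/(yy y).
  by field; rewrite qy Gy.
have [j Uj] := covU (f (aspt (yy (sval w)))).
have [b [c [cw fbc]]] := open_iso_frac mf (isoU j) Uj.
have [HE HN HR] := Hh j; have [R [S HRS]] := HR g.
move: HE HN HR HRS; set M := (h j).1.1; set N := (h j).2; rewrite /= -/(E j).
move=> HE HN _ HRS.
(* [g = E j * g'], and [g'] vanishes with [G]; so at [w] the denominator below reduces to [c]. *)
pose g' := D j * G.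
exists (phi j), (fun k => mlift n (b k) + mlift n (c * g') * S k),
  (mlift n c * (1 + mlift n g' * R)); split.
- by have [] := isoU j.
- rewrite mevalM meval_mlift mevalD meval1 mevalM meval_mlift mevalM.
  by rewrite -!/(yy (sval w)) Gw mulr0 mul0r addr0 mulr1.
move=> y; rewrite mevalM meval_mlift mevalD meval1 mevalM meval_mlift.
rewrite -!/(yy y) mulf_eq0 negb_or => /andP[cy Cy].
rewrite /f' /=; have [Gy|Gy] := eqVneq G.@[yy y] 0.
  rewrite fbc //; congr (phi _ (aspt _)); apply: functional_extensionality => k.
  rewrite !(mevalM, mevalD, meval_mlift, meval1) -!/(yy y) Gy.
  by rewrite !(mulr0, mul0r, addr0, mulr1).
have qy := q0 _ Gy.
have Ey : (E j).@[yy y] != 0.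
  by move: Gy; rewrite (GD j) mevalM mulf_eq0 negb_or => /andP[].
have gE : g.@[yy y] = (E j).@[yy y] * g'.@[yy y] by rewrite gG /g' (GD j) !mevalM; ring.
have [He HQ] := HRS y qy; rewrite -!/(xx y) -!/(yy y) in He HQ.
have qM : q.@[yy y] ^+ M != 0 by rewrite expf_neq0.
(* Up to a power of [q] this is [E j * (1 + g' * R)], so the transition to chart [j] is valid at the
   shifted point too. *)
have exx : (e j).@[xx y] != 0.
  suff : q.@[yy y] ^+ M * (e j).@[xx y] != 0.
    by rewrite mulf_eq0 negb_or => /andP[].
  by rewrite He gE -mulrA -[X in X + _]mulr1 -mulrDr mulf_neq0.
have ey : (e j).@[sval (frac_pt p q (yy y))] != 0.
  by move: Ey; rewrite HE // mulf_eq0 negb_or => /andP[].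
have [_ trans] := Hd j.
(* Both sides are coordinates of the same point of [X] in chart [j]. *)
have zE k : (Q j k).@[sval (frac_pt p q (yy y))] / (e j).@[sval (frac_pt p q (yy y))]
    = (b k).@[yy y] / c.@[yy y].
  have [_ injj _ _ _] := isoU j.
  have := fbc _ cy; rewrite fpq // trans // => /injj /(congr1 sval).
  by move=> /(congr1 (fun u => u k)).
rewrite trans //; congr (phi _ (aspt _)); apply: functional_extensionality => k.
have -> : (Q j k).@[xx y] / (e j).@[xx y] =
    (q.@[yy y] ^+ M * (Q j k).@[xx y]) / (q.@[yy y] ^+ M * (e j).@[xx y]).
  by field; rewrite exx qM.
have NE : (N k).@[yy y] = (E j).@[yy y] * ((b k).@[yy y] / c.@[yy y]).
  by rewrite HN // HE // -zE; field.
rewrite HQ He gE NE !(mevalM, mevalD, meval_mlift, meval1) -!/(yy y).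
rewrite mevalM in Cy.
exact: frac_shift_eq.
Qed.

(** * Induction over the charts *)

Lemma A_covered_A_image X : A_covered X -> A_image X.
Proof.
case=> varX irrX [n [_ [r [U [covU isoU]]]]]; split=> //.
have [[topX _ _] _] := varX.
have [phi Hphi] := fin_all_exists isoU.
have [x0 _] := irrX.1; have [i0 _] := covU x0.
(* Keeping [i0] at the head of the list supplies, at each step, the covered chart that
   [enlarge_image] requires. *)
have [m [f [mf Hf]]] : exists m (f : affine_space K m -> X), fmorphism f /\
    forall i, i \in i0 :: enum 'I_r -> forall x, U i x -> exists y, f y = x.
  elim: (enum 'I_r) => [|i s [m [f [mf Hf]]]].
    exists n, (phi i0); have [m0 _ U0 _ _] := Hphi i0; split=> // i.
    by rewrite mem_seq1 => /eqP -> x /U0.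
  have [f' [mf' imf imi]] :=
    enlarge_image i topX irrX covU Hphi mf (Hf i0 (mem_head _ _)).
  exists (m + n)%N, f'; split=> // j; rewrite !inE => /or3P[/eqP->|/eqP->|js] x Ux.
  - have [y <-] := Hf i0 (mem_head _ _) x Ux; exact: imf.
  - exact: imi.
  have [|y <-] := Hf j _ x Ux; first by rewrite inE js orbT.
  exact: imf.
exists m, f; split=> // x; have [i Ui] := covU x.
by apply: (Hf i) => //; rewrite inE mem_enum orbT.
Qed.

End AffineSpace.

Theorem theoremB (K : closedFieldType) (hK : [pchar K]%R =i pred0) (X : fspace K) :
  A_covered X -> A_image X.
Proof. exact: A_covered_A_image. Qed.
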